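(* For any integer $k\ge 1$, any algorithm $\mathcal{A}$ that, given query access to a graph $G(V,E)$ with $m$ edges, outputs a multiplicative approximation (of any factor) to the number of copies of the odd cycle $C_{2k+1}$ in $G$ with probability at least $2/3$ requires $\Omega\big(\frac{m^{k+1/2}}{\#C_{2k+1}}\big)$ queries to $G$.
   Context: Queries allowed to $G$: degree queries (return $d_v$), neighbor queries $(v,i)$ (return the $i$-th neighbor of $v$), pair queries $(u,v)$ (return whether $\{u,v\}\in E$), and edge-sample queries (return a uniformly random edge of $E$). $\#C_{2k+1}$ denotes the number of subgraphs of $G$ isomorphic to the cycle on $2k+1$ vertices.
   Formalization: The bound is proved as a worst case over graphs with #C_{2k+1} within a constant factor of any target T from C·m^{k-1/2} to m^{k+1/2}/C, for m ≥ C and at least C·m vertices; for far fewer cycles it fails, as O(m log m) edge samples reveal the whole graph. *)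

(* Defs.v *)
From Stdlib Require Import Reals.
From mathcomp Require Import all_boot.
Set Implicit Arguments. Unset Strict Implicit. Unset Printing Implicit Defensive.

(* Simple undirected graphs on the vertex set 'I_n, given by adjacency  *)
(* lists (the order of each list fixes the answers to neighbor queries). *)
Record graph (n : nat) := Graph {
  adj : 'I_n -> seq 'I_n;
  adj_uniq : forall v, uniq (adj v);
  adj_irrefl : forall v, v \notin adj v;
  adj_sym : forall u v, (u \in adj v) = (v \in adj u) }.

Definition deg n (G : graph n) (v : 'I_n) : nat := size (adj G v).

Definition edges n (G : graph n) : {set {set 'I_n}} :=
  [set e : {set 'I_n} | [exists u : 'I_n, exists v : 'I_n,
      (v \in adj G u) && (e == [set u; v])]].

Definition num_edges n (G : graph n) : nat := #|edges G|.

Definition cycle_edges n L (f : {ffun 'I_L -> 'I_n}) : {set {set 'I_n}} :=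
  [set [set f i; f (ordS i)] | i : 'I_L].

Definition cycle_embedding n L (G : graph n) : pred {ffun 'I_L -> 'I_n} :=
  [pred f : {ffun 'I_L -> 'I_n} | injectiveb f && [forall i : 'I_L, f (ordS i) \in adj G (f i)]].

(* #C_L : number of subgraphs of G isomorphic to C_L, i.e. number of
   distinct edge sets of embedded L-cycles. *)
Definition num_cycles n (G : graph n) (L : nat) : nat :=
  #|[set cycle_edges f | f in @cycle_embedding n L G]|.

(* Randomized query algorithms, as (possibly infinitely branching, but  *)
(* well-founded) decision trees over the vertex set 'I_n.               *)
Inductive alg (n : nat) : Type :=
| Out   (x : R)
| Flip  (p : R) (t1 t2 : alg n)
| QDeg  (v : 'I_n) (k : nat -> alg n)
| QNbr  (v : 'I_n) (i : nat) (k : option 'I_n -> alg n)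
        (* i-th neighbor (0-indexed) of v, None if i >= d_v *)
| QPair (u v : 'I_n) (k : bool -> alg n)
| QEdge (k : 'I_n * 'I_n -> alg n).              (* uniformly random edge *)

Arguments Out {n} x.

Local Open Scope R_scope.

Definition clamp01 (p : R) : R := Rmin 1 (Rmax 0 p).

Definition oriented_edges n (G : graph n) : seq ('I_n * 'I_n) :=
  [seq (u, v) | u <- enum 'I_n, v <- adj G u].

Fixpoint sumR (l : seq R) : R :=
  match l with nil => 0 | x :: l' => (x + sumR l') end.

Fixpoint prob n (G : graph n) (A : alg n) (P : R -> bool) : R :=
  match A with
  | Out x => if P x then 1 else 0
  | Flip p t1 t2 =>
      (clamp01 p * prob G t1 P + (1 - clamp01 p) * prob G t2 P)
  | QDeg v k => prob G (k (deg G v)) P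
  | QNbr v i k => prob G (k (nth None [seq Some w | w <- adj G v] i)) P
  | QPair u v k => prob G (k (u \in adj G v)) P
  | QEdge k =>
      (sumR [seq prob G (k e) P | e <- oriented_edges G]
        / INR (size (oriented_edges G)))
  end.

Definition maxl (l : seq nat) : nat := foldr maxn 0%N l.

(* Worst-case number of queries made by A on G, over all executions that
   have positive probability. *)
Fixpoint cost n (G : graph n) (A : alg n) : nat :=
  match A with
  | Out _ => 0%N
  | Flip p t1 t2 =>
      maxn (if Rlt_dec 0 (clamp01 p) then cost G t1 else 0%N)
           (if Rlt_dec (clamp01 p) 1 then cost G t2 else 0%N)
  | QDeg v k => (cost G (k (deg G v))).+1
  | QNbr v i k => (cost G (k (nth None [seq Some w | w <- adj G v] i))).+1
  | QPair u v k => (cost G (k (u \in adj G v))).+1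
  | QEdge k => (maxl [seq cost G (k e) | e <- oriented_edges G]).+1
  end.

(* x is a multiplicative lam-approximation of t: t/lam <= x <= lam*t
   (for t = 0 this forces x = 0). *)
Definition approxb (lam t : R) (x : R) : bool :=
  if Rle_dec (t / lam) x then (if Rle_dec x (lam * t) then true else false)
  else false.

(* Main.v *)
(* The hard instances are dense graphs on O(sqrt m) vertices: G0 is bipartite, so that
   there is no odd cycle, while in G_r a block of t cells of an s x s grid, s ~ sqrt m, is
   "switched", each cell trading two bipartite edges for two edges inside the colour
   classes. A switched cell creates ~ s^(2k-1) cycles, so t ~ T / s^(2k-1) cells give ~ T
   cycles, and the s^2 / t disjoint blocks give a family G_r of that size. Degrees never
   change, and every answer to a neighbour or pair query (and to an edge sample, which is
   the neighbour at a random position) depends on one cell, hence differs from G0's for at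
   most one r. By a hybrid argument q queries separate G0 from at most ~ q of the G_r,
   so that s^2 / t ~ m^(k+1/2) / T queries are needed. *)

Require Import Defs.
From Stdlib Require Import Reals Lra.
From mathcomp Require Import all_boot zify.
Set Implicit Arguments.
Unset Strict Implicit.
Unset Printing Implicit Defensive.
Local Open Scope R_scope.

(** * The hybrid argument *)

Lemma sumR_ext (I : eqType) (f g : I -> R) (s : seq I) :
  (forall i, i \in s -> f i = g i) ->
  sumR [seq f i | i <- s] = sumR [seq g i | i <- s].
Proof. by move=> fg; congr sumR; apply/eq_in_map. Qed.

Lemma sumR_le (I : eqType) (f g : I -> R) (s : seq I) :
  (forall i, i \in s -> f i <= g i) ->
  sumR [seq f i | i <- s] <= sumR [seq g i | i <- s].
Proof.
elim: s => [|i s IHs] /= le_fg; first exact: Rle_refl.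
apply: Rplus_le_compat; first by apply: le_fg; rewrite mem_head.
by apply: IHs => j js; apply: le_fg; rewrite inE js orbT.
Qed.

Lemma sumR_add (I : Type) (f g : I -> R) (s : seq I) :
  sumR [seq f i + g i | i <- s] = sumR [seq f i | i <- s] + sumR [seq g i | i <- s].
Proof. by elim: s => [|i s /= ->] /=; lra. Qed.

Lemma sumR_scale (I : Type) (c : R) (f : I -> R) (s : seq I) :
  sumR [seq c * f i | i <- s] = c * sumR [seq f i | i <- s].
Proof. by elim: s => [|i s /= ->] /=; lra. Qed.

Lemma sumR_const (I : Type) (c : R) (s : seq I) :
  sumR [seq c | _ <- s] = INR (size s) * c.
Proof.
elim: s => [|i s IHs]; first by rewrite /=; lra.
by rewrite [size _]/= S_INR /= IHs; lra.
Qed.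

Lemma sumR_exchange (I J : Type) (f : I -> J -> R) (s : seq I) (t : seq J) :
  sumR [seq sumR [seq f i j | j <- t] | i <- s] =
  sumR [seq sumR [seq f i j | i <- s] | j <- t].
Proof.
elim: s => [|i s /= ->] /=; first by rewrite sumR_const; lra.
by rewrite -sumR_add.
Qed.

Lemma clamp01_bounds (p : R) : 0 <= clamp01 p <= 1.
Proof.
rewrite /clamp01; split; first by apply: Rmin_glb; [lra | exact: Rmax_l].
exact: Rmin_l.
Qed.

Lemma mean_bounds (I : eqType) (f : I -> R) (s : seq I) :
  (forall i, i \in s -> 0 <= f i <= 1) ->
  0 <= sumR [seq f i | i <- s] / INR (size s) <= 1.
Proof.
move=> f01; have s_ge0 := pos_INR (size s).
have ge0 : 0 <= sumR [seq f i | i <- s].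
  have -> : 0 = sumR [seq 0 | _ <- s] by rewrite sumR_const; lra.
  by apply: sumR_le => i /f01 [].
have le_s : sumR [seq f i | i <- s] <= INR (size s).
  have -> : INR (size s) = sumR [seq 1 | _ <- s] by rewrite sumR_const; lra.
  by apply: sumR_le => i /f01 [].
(* An empty list, as for an edge sample in an edgeless graph, leads to a division by 0, whose value
   is 0. *)
case: (Req_dec (INR (size s)) 0) => s0.
  by rewrite s0 /Rdiv Rinv_0; lra.
have sinv : 0 < / INR (size s) by apply: Rinv_0_lt_compat; lra.
split; first by apply: Rmult_le_pos => //; lra.
by apply: (Rmult_le_reg_r (INR (size s))); [lra | rewrite /Rdiv Rmult_assoc Rinv_l //; lra].
Qed.

Lemma prob_disjoint_le1 n (G : graph n) (A : alg n) (P Q : R -> bool) :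
  (forall x, ~~ (P x && Q x)) -> 0 <= prob G A P + prob G A Q <= 1.
Proof.
move=> PQ; elim: A => [x|p t1 IH1 t2 IH2|v k IH|v i k IH|u v k IH|k IH] /=;
  try exact: IH.
- by move: (PQ x); case: (P x); case: (Q x) => //= _; lra.
- have := clamp01_bounds p; set c := clamp01 p => c01.
  by split; nra.
rewrite /Rdiv -Rmult_plus_distr_r -sumR_add.
exact: mean_bounds.
Qed.

Lemma prob_bounds n (G : graph n) (A : alg n) (P : R -> bool) :
  0 <= prob G A P <= 1.
Proof.
have disj : forall x, ~~ (P x && false) by move=> x; rewrite andbF.
have := prob_disjoint_le1 G A disj.
suff -> : prob G A (fun=> false) = 0 by lra.
elim: A {disj} => [x|p t1 IH1 t2 IH2|v k IH|v i k IH|u v k IH|k IH] //=.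
  by rewrite IH1 IH2; lra.
by rewrite (sumR_ext (g := fun=> 0)) // sumR_const; lra.
Qed.

(** A uniform edge is the neighbour at a uniform position [(u, i)]. The positions depend on the
    degrees only, so graphs with equal degrees share them. *)
Lemma oriented_edges_positions n (G : graph n) (d : 'I_n -> nat) :
  (forall v, deg G v = d v) ->
  oriented_edges G =
  [seq (p.1, nth p.1 (adj G p.1) p.2) | p <- [seq (u, i) | u <- enum 'I_n, i <- iota 0 (d u)]].
Proof.
move=> degG; rewrite /oriented_edges; elim: (enum _) => //= u s IH.
rewrite map_cat -IH; congr (_ ++ _).
rewrite -map_comp -degG -[in LHS](mkseq_nth u (adj G u)) /mkseq -map_comp.
exact: eq_map.
Qed.

Lemma leq_maxl (x : nat) (s : seq nat) : x \in s -> (x <= maxl s)%N.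
Proof.
by elim: s => //= y s IH; rewrite inE leq_max => /orP[/eqP->|/IH ->]; rewrite ?leqnn ?orbT.
Qed.

(** * One-hit families and the hybrid inequality *)

Definition nbr n (G : graph n) (v : 'I_n) (i : nat) : option 'I_n :=
  nth None [seq Some w | w <- adj G v] i.

(** Any single query tells at most one [G r] apart from [G0]. Edge samples get no clause of their
    own: equal degrees reduce them to neighbour queries at random positions. *)
Record one_hit n (I : Type) (G0 : graph n) (G : I -> graph n) : Prop := OneHit {
  hit_deg : forall r v, deg (G r) v = deg G0 v;
  hit_nbr : forall v i r r', nbr (G r) v i <> nbr G0 v i ->
    nbr (G r') v i <> nbr G0 v i -> r = r';
  hit_pair : forall u v r r', (u \in adj (G r) v) <> (u \in adj G0 v) ->
    (u \in adj (G r') v) <> (u \in adj G0 v) -> r = r' }.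

Section Hybrid.

Variables (n : nat) (I : eqType) (G0 : graph n) (G : I -> graph n).
Hypothesis hitG : one_hit G0 G.
Variable P : R -> bool.

Lemma count_hits (X : eqType) (ans : I -> X) (ans0 : X) (rs : seq I) :
  (forall r r', ans r <> ans0 -> ans r' <> ans0 -> r = r') -> uniq rs ->
  (count (fun r => ans r != ans0) rs <= 1)%N.
Proof.
move=> hit uniq_rs; rewrite -size_filter.
have := filter_uniq (fun r => ans r != ans0) uniq_rs.
have : all (fun r => ans r != ans0) [seq r <- rs | ans r != ans0] by exact: filter_all.
case: [seq _ <- _ | _] => [|a [|b s]] //= /and3P[/eqP ha /eqP hb _].
by rewrite (hit _ _ ha hb) inE eqxx.
Qed.

(** Each query lowers the sum by at most 1, because it singles out at most one member. The bound
    ranges over all lists [rs] so that an induction can drop that member. *)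
Definition hybrid_bound (A : alg n) : Prop :=
  forall (rs : seq I) (q : nat), uniq rs ->
  (forall r, r \in rs -> (cost (G r) A <= q)%N) ->
  INR (size rs) * prob G0 A P - INR q <= sumR [seq prob (G r) A P | r <- rs].

(** The at most one member with a deviating answer is discarded, a loss of at most 1 that the query
    pays for. All others continue in [k ans0] with one query less. *)
Lemma hybrid_query (X : eqType) (ans : I -> X) (ans0 : X) (k : X -> alg n)
    (rs : seq I) (q : nat) :
  (forall r r', ans r <> ans0 -> ans r' <> ans0 -> r = r') ->
  hybrid_bound (k ans0) -> uniq rs ->
  (forall r, r \in rs -> ((cost (G r) (k (ans r))).+1 <= q)%N) ->
  INR (size rs) * prob G0 (k ans0) P - INR q <=
    sumR [seq prob (G r) (k (ans r)) P | r <- rs].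
Proof.
move=> hit IH uniq_rs; case: q => [|q] le_q.
  (* With [q = 0] the list is empty, as every member makes a query. *)
  case: rs uniq_rs le_q => [|r rs] _ le_q /=; first lra.
  by have := le_q r (mem_head _ _).
pose good r := ans r == ans0.
have le_good : sumR [seq prob (G r) (k ans0) P | r <- filter good rs] <=
    sumR [seq prob (G r) (k (ans r)) P | r <- rs].
  elim: (rs) => /= [|r s IHs]; first lra.
  case: ifPn => [/eqP -> /=|_]; first lra.
  by have := prob_bounds (G r) (k (ans r)) P; lra.
have := IH (filter good rs) q (filter_uniq _ uniq_rs).
have : INR (size rs) <= INR (size (filter good rs)) + 1.
  rewrite -S_INR; apply: le_INR; apply/leP.
  have := count_predC good rs; rewrite size_filter.
  have := count_hits hit uniq_rs; rewrite /good /predC /=.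
  by move=> ? <-; rewrite -addn1 leq_add2l.
move=> le_size; move: le_good.
set S := sumR _; set S' := sumR _ => le_good le_IH.
have {le_IH} := le_IH _; have := prob_bounds G0 (k ans0) P.
rewrite S_INR => pb /(_ _) le_IH.
have : INR (size (filter good rs)) * prob G0 (k ans0) P - INR q <= S.
  apply: le_IH => r; rewrite mem_filter => /andP[/eqP good_r r_rs].
  by have := le_q r r_rs; rewrite good_r ltnS.
by nra.
Qed.

Lemma hybrid (A : alg n) : hybrid_bound A.
Proof.
elim: A => [x|p t1 IH1 t2 IH2|v k IH|v i k IH|u v k IH|k IH] rs q uniq_rs le_q /=.
- by rewrite sumR_const; have := pos_INR q; lra.
- have := clamp01_bounds p; move: le_q => /=; set c := clamp01 p => le_q c01.
  rewrite sumR_add !sumR_scale.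
  (* [cost] sees a branch only if its probability is positive, so each induction hypothesis holds
     only then; the values 0 and 1 of [c] are treated apart. *)
  have {}IH1 : 0 < c -> INR (size rs) * prob G0 t1 P - INR q <=
      sumR [seq prob (G r) t1 P | r <- rs].
    move=> c_gt0; apply: IH1 => // r /le_q; rewrite geq_max => /andP[+ _].
    by case: Rlt_dec.
  have {}IH2 : c < 1 -> INR (size rs) * prob G0 t2 P - INR q <=
      sumR [seq prob (G r) t2 P | r <- rs].
    move=> c_lt1; apply: IH2 => // r /le_q; rewrite geq_max => /andP[_ +].
    by case: Rlt_dec.
  case: (Req_dec c 0) => [c0|c_n0]; first by rewrite c0 in IH2 *; lra.
  case: (Req_dec c 1) => [c1|c_n1]; first by rewrite c1 in IH1 *; lra.
  by have := IH1 _; have := IH2 _; nra.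
- rewrite -(sumR_ext (f := fun r => prob (G r) (k (deg (G r) v)) P)) //.
  apply: hybrid_query => // r r'; by rewrite !(hit_deg hitG).
- exact: (hybrid_query (hit_nbr hitG (v := v) (i := i))).
- exact: (hybrid_query (hit_pair hitG (u := u) (v := v))).
(* All graphs share the positions [pos]. After exchanging the two sums, the bound is proved at each
   position as for a neighbour query, then averaged. *)
pose pos := [seq (u, i) | u <- enum 'I_n, i <- iota 0 (deg G0 u)].
pose ans H (p : 'I_n * nat) := (p.1, nth p.1 (adj H p.1) p.2).
have E0 : oriented_edges G0 = map (ans G0) pos by exact: oriented_edges_positions.
have EG r : oriented_edges (G r) = map (ans (G r)) pos.
  exact/oriented_edges_positions/hit_deg.
set d := INR (size pos).
have -> : sumR [seq prob G0 (k e) P | e <- oriented_edges G0] /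
    INR (size (oriented_edges G0)) = / d * sumR [seq prob G0 (k (ans G0 p)) P | p <- pos].
  by rewrite E0 size_map -map_comp Rmult_comm.
rewrite (sumR_ext (g := fun r => / d * sumR [seq prob (G r) (k (ans (G r) p)) P | p <- pos]));
  last by move=> r _; rewrite EG size_map -map_comp Rmult_comm.
rewrite sumR_scale sumR_exchange.
have [d0|d_neq0] := Req_dec d 0.
  by rewrite d0 Rinv_0; have := pos_INR q; lra.
have dinv_gt0 : 0 < / d by apply: Rinv_0_lt_compat; have := pos_INR (size pos); rewrite -/d; lra.
have -> : INR q = / d * (d * INR q) by field.
have := @sumR_le _ (fun p => INR (size rs) * prob G0 (k (ans G0 p)) P + - INR q)
  (fun p => sumR [seq prob (G r) (k (ans (G r) p)) P | r <- rs]) pos.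
rewrite sumR_add sumR_scale sumR_const -/d.
set S0 := sumR _; set S1 := sumR _ => le_S.
suff le_S1 : INR (size rs) * S0 + d * - INR q <= S1 by nra.
apply: le_S => -[u i] /= pos_ui.
apply: (@hybrid_query _ (fun r => ans (G r) (u, i)) (ans G0 (u, i)) k) => //.
  (* Past the end of a list [ans] returns the default [u] in both graphs, so deviating answers
     always come from deviating neighbour queries. *)
  have neq r : ans (G r) (u, i) <> ans G0 (u, i) -> nbr (G r) u i <> nbr G0 u i.
    rewrite /ans /nbr /=; case: (ltnP i (deg G0 u)) => [lt_i|le_i] neq eq_nbr; apply: neq.
      by move: eq_nbr; rewrite !(nth_map u) -/(deg _ _) ?(hit_deg hitG) // => -[->].
    by rewrite !nth_default // -/(deg _ _) ?(hit_deg hitG).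
  by move=> r r' /neq + /neq; exact: (hit_nbr hitG).
move=> r /le_q; apply: leq_trans; rewrite ltnS; apply: leq_maxl.
by apply: map_f; rewrite EG; apply: map_f.
Qed.

End Hybrid.

(** An approximation of 0 is at most 0, while one of [t] is at least [t / lam > 0]. *)
Lemma approx_zero_disjoint (lam t x : R) :
  1 <= lam -> 0 < t -> ~~ (approxb lam 0 x && approxb lam t x).
Proof.
move=> lam1 t_gt0; rewrite /approxb.
have : 0 < t / lam by apply: Rdiv_lt_0_compat; lra.
case: Rle_dec => //= _; case: Rle_dec => //= le_x.
by case: Rle_dec => // *; lra.
Qed.

(* An algorithm that is right on [G0] and on every [G r] separates them, hence
   by the hybrid bound makes [|I| / 3] queries on some [G r]. *)
Lemma one_hit_cost n (I : finType) (G0 : graph n) (G : I -> graph n) (A : alg n)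
    (lam : R) (t : I -> R) :
  one_hit G0 G -> (0 < #|I|)%N -> 1 <= lam -> (forall r, 0 < t r) ->
  2 / 3 <= prob G0 A (approxb lam 0) ->
  (forall r, 2 / 3 <= prob (G r) A (approxb lam (t r))) ->
  exists r, INR #|I| / 3 <= INR (cost (G r) A).
Proof.
move=> hitG /card_gt0P[r0 _] lam1 t_gt0 good0 goodG.
pose r := [arg max_(i > r0) cost (G i) A]; exists r.
have r_max i : (cost (G i) A <= cost (G r) A)%N.
  by rewrite /r; case: arg_maxnP => // j _; exact.
have := hybrid hitG (approxb lam 0) (A := A) (enum_uniq I) (fun i _ => r_max i).
have -> : size (enum I) = #|I| by rewrite -cardE.
(* Answers good for [G0] are wrong for [G i], hence have probability at most 1/3 there, against 2/3
   on [G0]. *)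
have : sumR [seq prob (G i) A (approxb lam 0) | i <- enum I] <=
    sumR [seq 1 / 3 | i <- enum I].
  apply: sumR_le => i _.
  have disj x := approx_zero_disjoint x lam1 (t_gt0 i).
  by have := prob_disjoint_le1 (G i) A disj; have := goodG i; lra.
rewrite sumR_const.
have -> : size (enum I) = #|I| by rewrite -cardE.
have := Rmult_le_compat_l _ _ _ (pos_INR #|I|) good0.
set N := INR #|I|; set S := sumR _; lra.
Qed.

(** * Cycles and their embeddings *)

Local Open Scope nat_scope.

(** This bound and the next double count the pairs [(x, i)] with [x \in F i]. *)
Lemma leq_card_covering (T I : finType) (D : {pred T}) (J : {pred I})
    (F : I -> {pred T}) (c : nat) :
  (forall x, x \in D -> exists2 i, i \in J & x \in F i) ->
  (forall i, i \in J -> #|F i| <= c) -> #|D| <= #|J| * c.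
Proof.
move=> cov le_c; rewrite -sum_nat_const.
apply: (@leq_trans (\sum_(i in J) #|F i|)); last by apply: leq_sum => i /le_c.
rewrite -sum1_card.
apply: (@leq_trans (\sum_(x in D) \sum_(i in J | x \in F i) 1)).
  apply: leq_sum => x /cov[i iJ xFi].
  by rewrite (bigD1 i) ?iJ.
rewrite (exchange_big_dep (mem J)) /=; last by move=> x i _ /andP[].
apply: leq_sum => i iJ; rewrite -sum1_card iJ /=.
rewrite [leqRHS](bigID (mem D)) /= -[leqLHS]addn0 leq_add //.
by rewrite leq_eqVlt; apply/orP; left; apply/eqP; apply: eq_bigl => x; rewrite andbC.
Qed.

Lemma leq_card_packing (T I : finType) (D : {pred T}) (J : {pred I})
    (F : I -> {pred T}) (c : nat) :
  (forall i x, i \in J -> x \in F i -> x \in D) ->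
  (forall i j x, i \in J -> j \in J -> x \in F i -> x \in F j -> i = j) ->
  (forall i, i \in J -> c <= #|F i|) -> #|J| * c <= #|D|.
Proof.
move=> sub disj le_c; rewrite -sum_nat_const.
apply: (@leq_trans (\sum_(i in J) #|F i|)); first by apply: leq_sum => i /le_c.
rewrite (eq_bigr (fun i => \sum_(x in D | x \in F i) 1)); last first.
  move=> i iJ; rewrite -sum1_card; apply: eq_bigl => x.
  by case xF: (x \in F i); rewrite ?andbF // (sub i).
rewrite (exchange_big_dep (mem D)) /=; last by move=> i x _ /andP[].
rewrite -sum1_card; apply: leq_sum => x xD.
case: (pickP (fun i => (i \in J) && (x \in F i))) => [i /andP[iJ xi]|no].
  rewrite (bigD1 i) ?iJ ?xD ?xi //= big1 // => j.
  by case/andP=> /andP[jJ xj] /eqP[]; apply: disj xj xi.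
rewrite big1 // => i /and3P[iJ _ xi]; by have := no i; rewrite iJ xi.
Qed.

Lemma card_family_prod (aT rT : finType) (F : aT -> pred rT) :
  #|family F| = \prod_x #|F x|.
Proof. by rewrite card_family foldrE big_image. Qed.

(** Each edge comes from exactly two ordered pairs: covering gives one inequality, packing the
    other. *)
Lemma handshake n (G : graph n) : \sum_v deg G v = num_edges G * 2.
Proof.
have cardO : \sum_v deg G v = #|[pred p : 'I_n * 'I_n | p.2 \in adj G p.1]|.
  rewrite -sum1_card -(pair_big_dep xpredT (fun u v => v \in adj G u) (fun _ _ => 1)) /=.
  apply: eq_bigr => v _; rewrite sum1_card /deg.
  by rewrite -(card_uniqP (adj_uniq G v)).
pose F (e : {set 'I_n}) : pred ('I_n * 'I_n) :=
  [pred p | (p.2 \in adj G p.1) && (e == [set p.1; p.2])].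
have cardF e : e \in edges G -> #|F e| = 2.
  rewrite inE => /existsP[u /existsP[v /andP[uv /eqP ->]]].
  have neq_uv : u != v.
    by apply: contraTneq uv => ->; exact: adj_irrefl.
  rewrite (eq_card (B := pred2 (u, v) (v, u))); last first.
    move=> [a b]; rewrite !inE /= -!pair_eqE /=; apply/idP/idP; last first.
      by case/orP => /andP[/eqP-> /eqP->]; rewrite ?uv -1?adj_sym ?uv ?eqxx ?[[set v; u]]setUC //=.
    case/andP=> ab /eqP eq_e.
    have neq_ab : a != b by apply: contraTneq ab => ->; exact: adj_irrefl.
    have : a \in [set u; v] by rewrite eq_e set21.
    have : b \in [set u; v] by rewrite eq_e set22.
    rewrite !inE => /orP[]/eqP eb /orP[]/eqP ea; move: neq_ab; rewrite ea eb ?eqxx //= ?orbT //.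
  rewrite card2 -pair_eqE /= negb_and neq_uv //.
apply/eqP; rewrite cardO eqn_leq; apply/andP; split.
  apply: (leq_card_covering (F := F)) => [[u v] uv|e /cardF -> //].
  exists [set u; v]; last by rewrite inE /= eqxx andbT.
  by rewrite inE; apply/existsP; exists u; apply/existsP; exists v; rewrite eqxx andbT.
apply: (leq_card_packing (F := F)) => [e p _|e e' p _ _|e /cardF -> //].
  by case/andP.
by move=> /andP[_ /eqP ->] /andP[_ /eqP ->].
Qed.

Lemma num_cycles_le n (G : graph n) (L : nat) :
  num_cycles G L <= #|@cycle_embedding n L G|.
Proof. exact: leq_imset_card. Qed.

(* The edge set of a cycle determines its vertex set, so at most [L ^ L]
   embeddings trace the same cycle. *)
Lemma le_num_cycles n (G : graph n) (L : nat) :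
  #|@cycle_embedding n L G| <= num_cycles G L * L ^ L.
Proof.
pose F (S : {set {set 'I_n}}) : pred {ffun 'I_L -> 'I_n} :=
  [pred f | cycle_edges f == S].
apply: (leq_card_covering (F := F)) => [f emb_f|S /imsetP[f _ ->]].
  by exists (cycle_edges f); rewrite ?inE // imset_f.
have le_L : #|[set f x | x : 'I_L]| <= L.
  by apply: leq_trans (leq_imset_card _ _) _; rewrite card_ord.
apply: (@leq_trans (#|[set f x | x : 'I_L]| ^ #|'I_L|)); last first.
  have leX a b : a <= b -> a ^ b <= b ^ b by case: b => // b ab; rewrite leq_exp2r.
  by rewrite card_ord leX.
rewrite -card_ffun_on.
apply/subset_leq_card/subsetP => g /eqP eq_gf.
apply/ffun_onP => i.
have : [set g i; g (ordS i)] \in cycle_edges g by exact: imset_f.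
rewrite eq_gf => /imsetP[j _ eq_ij].
have : g i \in [set f j; f (ordS j)] by rewrite -eq_ij set21.
by rewrite !inE => /orP[]/eqP->; exact: imset_f.
Qed.

(** Otherwise every step flips the colour, and an odd number of flips returns to the start with the
    wrong colour. *)
Lemma odd_walk_monochromatic (L : nat) (col : 'I_L -> bool) :
  odd L -> exists i, col (ordS i) = col i.
Proof.
move=> oddL; have L_gt0 : 0 < L by case: L oddL col.
case: (pickP (fun i => col (ordS i) == col i)) => [i /eqP ? | no]; first by exists i.
pose o i := Ordinal (ltn_pmod i L_gt0).
have col_o i : col (o i) = odd i (+) col (o 0).
  elim: i => //= i IHi; have := no (o i).
  have -> : ordS (o i) = o i.+1 by apply: val_inj; rewrite /= -addn1 modnDml addn1.
  by rewrite IHi; case: (col _); case: (odd i); case: (col _).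
have := col_o L; rewrite oddL.
have -> : o L = o 0 by apply: val_inj; rewrite /= modnn mod0n.
by case: (col _).
Qed.

(** An odd cycle makes a monochromatic step, which lies in [Pl]. Choosing its place and its pair
    leaves [L - 2] vertices free in [W]. *)
Lemma card_cycle_embedding_le n (G : graph n) (L : nat) (col : 'I_n -> bool)
    (W : {set 'I_n}) (Pl : {set 'I_n * 'I_n}) :
  odd L -> 1 < L ->
  (forall u v, v \in adj G u -> u \in W) ->
  (forall u v, v \in adj G u -> col v = col u -> (u, v) \in Pl) ->
  #|@cycle_embedding n L G| <= L * #|Pl| * #|W| ^ (L - 2).
Proof.
move=> oddL L_gt1 inW inPl.
pose F (d : 'I_L * ('I_n * 'I_n)) (j : 'I_L) : pred 'I_n :=
  if j == d.1 then pred1 d.2.1 else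
  if j == ordS d.1 then pred1 d.2.2 else mem W.
have -> : L * #|Pl| = #|setX [set: 'I_L] Pl| by rewrite cardsX cardsT card_ord.
have ordS_neq (i : 'I_L) : ordS i != i.
  rewrite -val_eqE /=; case: (ltnP i.+1 L) => [lt|ge].
    by rewrite modn_small // gtn_eqF.
  have -> : i.+1 = L by apply/eqP; rewrite eqn_leq ge ltn_ord.
  rewrite modnn; lia.
apply: (leq_card_covering (F := fun d => [pred f : {ffun 'I_L -> 'I_n} | f \in family (F d)])).
  move=> f /andP[_ /forallP adj_f].
  have [i col_i] := odd_walk_monochromatic (col \o f) oddL.
  exists (i, (f i, f (ordS i))); first by rewrite !inE inPl.
  apply/familyP => j; rewrite /F /=; case: eqP => [->|_]; first exact: eqxx.
  by case: eqP => [->|_]; [exact: eqxx | exact: inW (adj_f j)].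
move=> [i [u v]] _; rewrite (eq_card (B := family (F (i, (u, v))))) // card_family_prod.
rewrite (bigD1 i) //= (bigD1 (ordS i)) //= /F /= !eqxx (negbTE (ordS_neq i)) !card1 !mul1n.
rewrite (eq_bigr (fun _ => #|W|)); last first.
  by move=> j /andP[/negbTE-> /negbTE->].
rewrite prod_nat_const.
suff -> : #|[pred j | (j != i) && (j != ordS i)]| = L - 2 by [].
have := cardC (pred2 i (ordS i)).
rewrite card2 eq_sym ordS_neq card_ord /= => eqL; rewrite -[in RHS]eqL addKn.
by apply: eq_card => j; rewrite !inE negb_or.
Qed.

(** * The planted graphs *)

(* Four classes of size [s], A = [inl (true, false, _)], A' = [inl (false, false, _)],
   B = [inl (false, true, _)], B' = [inl (true, true, _)], then Y of size [s] and X
   of size [b]. Cell (i, j) chooses between the edges A_i B_j, A'_j B'_i and the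
   planted edges A_i A'_j, B_j B'_i; either way the neighbour of A_i (or B'_i) in
   position j, and that of A'_j (or B_j) in position i, is decided by this cell alone. *)
Notation core s b := ((bool * bool * 'I_s) + ('I_s + 'I_b))%type.

(** Vertices with [p = true] index rows and those with [p = false] columns, so both ends of an edge
    name the same cell. *)
Definition cell s (p : bool) (i j : 'I_s) : 'I_s * 'I_s := if p then (i, j) else (j, i).

Section Planted.

Variables (s b n : nat) (S : {set 'I_b * 'I_s}) (emb : core s b -> 'I_n).
Hypothesis emb_inj : injective emb.
Implicit Types (M : {set 'I_s * 'I_s}) (u v : core s b).

Definition gadget M v : seq (core s b) :=
  if v is inl (p, c, i)
  then [seq inl (~~ p, c (+) (cell p i j \notin M), j) | j <- enum 'I_s] else [::].

(** Edges common to all planted graphs: Y is joined to all of A and A', and to X along [S]. They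
    supply the paths that close planted edges, and the size of [S] tunes the number of edges. *)
Definition spoke v u : bool :=
  match v, u with
  | inl (_, c, _), inr (inl _) | inr (inl _), inl (_, c, _) => ~~ c
  | inr (inl l), inr (inr a) | inr (inr a), inr (inl l) => (a, l) \in S
  | _, _ => false
  end.

(** The gadget part comes first and its length does not depend on [M], so spokes keep their
    positions. *)
Definition core_adj M v : seq (core s b) := gadget M v ++ [seq u <- enum {: core s b} | spoke v u].

Definition core_rel M v u : bool :=
  match v, u with
  | inl (p, c, i), inl (p', c', j) => (p' == ~~ p) && (c' == c (+) (cell p i j \notin M))
  | _, _ => spoke v u
  end.

Lemma mem_core_adj M v u : (u \in core_adj M v) = core_rel M v u.
Proof.
rewrite mem_cat mem_filter mem_enum andbT.
case: v => [[[p c] i]|[l|a]] //=; case: u => [[[p' c'] j]|[l'|a']] //=;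
  rewrite ?orbF.
- apply/mapP/andP => [[j' _ [-> -> ->]]|[/eqP -> /eqP ->]]; first by rewrite !eqxx.
  by exists j; rewrite ?mem_enum.
- by case: mapP => // -[].
- by case: mapP => // -[].
Qed.

Lemma core_rel_sym M v u : core_rel M v u = core_rel M u v.
Proof.
case: v => [[[p c] i]|[l|a]] //=; case: u => [[[p' c'] j]|[l'|a']] //=.
have -> : (p' == ~~ p) = (p == ~~ p') by case: p p' => [] [].
case: eqP => //= ->; have -> : cell (~~ p') i j = cell p' j i by case: p'.
by case: (_ \in M); case: c c' => [] [].
Qed.

Lemma core_rel_irrefl M v : core_rel M v v = false.
Proof. by case: v => [[[[] c] i]|[l|a]]. Qed.

Lemma core_adj_uniq M v : uniq (core_adj M v).
Proof.
rewrite cat_uniq filter_uniq ?enum_uniq // andbT.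
case: v => [[[p c] i]|[l|a]] /=; rewrite ?andbT; last first.
- by apply/hasPn.
- by apply/hasPn.
rewrite map_inj_uniq ?enum_uniq /=; last by move=> j j' [].
by apply/hasPn => u; rewrite mem_filter => /andP[+ _]; case: u => //= y _; apply/mapP => -[].
Qed.

(** Vertices outside the image of [emb] are isolated padding. *)
Definition gadj M (x : 'I_n) : seq 'I_n :=
  if [pick v | emb v == x] is Some v then map emb (core_adj M v) else [::].

Lemma gadj_emb M v : gadj M (emb v) = map emb (core_adj M v).
Proof.
rewrite /gadj; case: pickP => [w /eqP /emb_inj -> //|/(_ v)].
by rewrite eqxx.
Qed.

Lemma gadjP M (x y : 'I_n) :
  reflect (exists v u, [/\ x = emb v, y = emb u & core_rel M v u]) (y \in gadj M x).
Proof.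
apply: (iffP idP) => [|[v [u [-> -> vu]]]]; last by rewrite gadj_emb mem_map ?mem_core_adj.
rewrite /gadj; case: pickP => // v /eqP <- /mapP[u + ->].
by rewrite mem_core_adj; exists v, u.
Qed.

Lemma gadj_uniq M x : uniq (gadj M x).
Proof. by rewrite /gadj; case: pickP => // v _; rewrite map_inj_uniq // core_adj_uniq. Qed.

Lemma gadj_irrefl M x : x \notin gadj M x.
Proof.
by apply/gadjP => -[v [u [-> /emb_inj -> ]]]; rewrite core_rel_irrefl.
Qed.

Lemma gadj_sym M x y : (x \in gadj M y) = (y \in gadj M x).
Proof. by apply/gadjP/gadjP => -[v [u [-> -> vu]]]; exists u, v; rewrite core_rel_sym. Qed.

Definition planted M : graph n := Graph (@gadj_uniq M) (@gadj_irrefl M) (@gadj_sym M).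

Lemma size_core_adj M v :
  size (core_adj M v) = (if v is inl _ then s else 0) + \sum_u spoke v u.
Proof.
rewrite size_cat; congr (_ + _); last first.
  by rewrite -sum1_size big_filter big_enum_cond big_mkcond; apply: eq_bigr => u _; case: spoke.
by case: v => [[[p c] i]|[l|a]] //=; rewrite size_map size_enum_ord.
Qed.

Lemma deg_planted M x : deg (planted M) x = deg (planted set0) x.
Proof.
rewrite /deg /= /gadj; case: pickP => // v _.
by rewrite !size_map !size_core_adj.
Qed.

(** A gadget position is governed by a single cell. Where the answer ignores [M], [(o, o)] serves as
    a dummy cell. *)
Lemma nbr_planted (x : 'I_n) (i : nat) : 0 < s ->
  exists d, forall M, d \notin M -> nbr (planted M) x i = nbr (planted set0) x i.
Proof.
move=> s_gt0; pose o := Ordinal s_gt0; rewrite /nbr /= /gadj.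
case: pickP => [v _|_]; last by exists (o, o).
case: v => [[[p c] j]|v]; last by exists (o, o).
have sz M : size [seq Some w | w <- map emb (gadget M (inl (p, c, j)))] = s.
  by rewrite 3!size_map size_enum_ord.
rewrite /core_adj; case: (ltnP i s) => [lt_i|le_i]; last first.
  by exists (o, o) => M _; rewrite !map_cat !nth_cat !sz ltnNge le_i.
exists (cell p j (Ordinal lt_i)) => M dM.
have nth_gadget M' : nth None [seq Some w | w <- map emb (gadget M' (inl (p, c, j)))] i =
    Some (emb (inl (~~ p, c (+) (cell p j (Ordinal lt_i) \notin M'), Ordinal lt_i))).
  rewrite /gadget -2!map_comp (nth_map (Ordinal lt_i)) ?size_enum_ord //=.
  by rewrite (nth_ord_enum _ (Ordinal lt_i)).
by rewrite !map_cat !nth_cat !sz lt_i !nth_gadget dM inE.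
Qed.

Lemma pair_planted (x y : 'I_n) : 0 < s ->
  exists d, forall M, d \notin M -> (x \in adj (planted M) y) = (x \in adj (planted set0) y).
Proof.
move=> s_gt0; pose o := Ordinal s_gt0; rewrite /= /gadj.
case: pickP => [v _|_]; last by exists (o, o).
have [/codomP[u ->]|x_out] := boolP (x \in codom emb); last first.
  exists (o, o) => M _; apply/mapP/mapP => -[u _ eq_x]; by rewrite eq_x codom_f in x_out.
case: v u => [[[p c] i]|v] [[[p' c'] j]|u];
  [exists (cell p i j) | exists (o, o) ..] => M dM; rewrite !mem_map // !mem_core_adj //=.
by rewrite dM inE.
Qed.

(** A changed answer forces the deciding cell into [Ms r], and disjoint sets cannot both contain
    it. *)
Lemma planted_one_hit (I : Type) (Ms : I -> {set 'I_s * 'I_s}) : 0 < s ->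
  (forall r r' d, d \in Ms r -> d \in Ms r' -> r = r') ->
  one_hit (planted set0) (fun r => planted (Ms r)).
Proof.
move=> s_gt0 disj; split => [r v|v i r r'|u v r r'].
- exact: deg_planted.
- have [d same] := nbr_planted v i s_gt0.
  by move=> hr hr'; apply: (disj _ _ d); apply/negPn/negP => /same.
have [d same] := pair_planted u v s_gt0.
by move=> hr hr'; apply: (disj _ _ d); apply/negPn/negP => /same.
Qed.

(** Two edges per cell and the complete join of Y to A and A' give [2 * s ^ 2] each; X and Y add
    [#|S|]. *)
Lemma num_edges_planted M : num_edges (planted M) = 4 * s ^ 2 + #|S|.
Proof.
apply/eqP; rewrite -(eqn_pmul2r (isT : 0 < 2)) -handshake.
rewrite (bigID (mem (emb @: [set: core s b]))) /= [X in _ + X]big1 ?addn0; last first.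
  move=> x; rewrite /deg /= /gadj; case: pickP => // v /eqP <-.
  by rewrite imset_f.
rewrite big_imset /=; last by move=> v u _ _ /emb_inj.
rewrite (eq_bigr (fun v : core s b => (if v is inl _ then s else 0) + \sum_u spoke v u));
  last by move=> v _; rewrite /deg /= gadj_emb size_map size_core_adj.
rewrite (eq_bigl xpredT) => [|v]; last by rewrite inE.
rewrite big_split /= !big_sumType /=.
have cardS : #|S| = \sum_a \sum_l ((a, l) \in S).
  rewrite pair_bigA -sum1_card big_mkcond /=.
  by apply: eq_bigr => -[a l] _; case: (_ \in S).
have cardS' : #|S| = \sum_l \sum_a ((a, l) \in S) by rewrite exchange_big.
have inner (x : bool * bool * 'I_s) : \sum_u spoke (inl x) u = s * ~~ x.1.2.
  case: x => [[p c] i]; rewrite !big_sumType /= big1; last by case=> [[? ?] ?].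
  rewrite add0n [X in _ + X]big1 // addn0.
  by rewrite sum_nat_const card_ord.
have outer : \sum_(x : bool * bool * 'I_s) ~~ x.1.2 = 2 * s.
  rewrite -(pair_bigA _ (fun (pc : bool * bool) (_ : 'I_s) => nat_of_bool (~~ pc.2))) /=.
  rewrite -(pair_bigA _ (fun (_ c : bool) => \sum_(_ : 'I_s) ~~ c)) /=.
  rewrite !big_bool /= !sum_nat_const card_ord; lia.
rewrite (eq_bigr _ (fun x _ => inner x)) -big_distrr /= outer.
rewrite [X in _ + (_ + (X + _))](eq_bigr (fun l => 2 * s + \sum_a ((a, l) \in S))); last first.
  move=> l _; rewrite !big_sumType /= [X in _ + (X + _)]big1 // add0n; congr (_ + _).
  by rewrite -outer; apply: eq_bigr => -[[p c] i].
rewrite big_split /= -cardS'.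
rewrite [X in _ + (_ + (_ + X))](eq_bigr (fun a => \sum_l ((a, l) \in S))); last first.
  move=> a _; rewrite !big_sumType /= big1 ?add0n; last by case=> [[p c] i].
  by rewrite [X in _ + X]big1 ?addn0.
rewrite -cardS !sum_nat_const !card_ord.
have -> : #|xpredT : pred (bool * bool * 'I_s)| = 4 * s.
  by rewrite (eq_card (B := {: bool * bool * 'I_s})) // !card_prod card_bool card_ord; lia.
rewrite -mulnn !muln0 [s * (2 * s)]mulnCA -mulnA; apply/eqP.
by move: (s * s) #|S| => s2 q; lia.
Qed.

(* A proper 2-colouring of all edges but the planted ones. *)
Definition colour v : bool :=
  match v with inl (_, c, _) => c | inr (inl _) => true | inr (inr _) => false end.

(** A switched cell has two planted edges: [c] selects one of them and [p] its orientation. *)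
Definition planted_edge (d : (bool * bool) * ('I_s * 'I_s)) : 'I_n * 'I_n :=
  let: ((p, c), (i, j)) := d in
  let: (i', j') := cell p i j in (emb (inl (p, c, i')), emb (inl (~~ p, c, j'))).

(** Only the at most [4 * #|M|] oriented planted edges are monochromatic. For empty [M] this
    excludes odd cycles altogether. *)
Lemma card_planted_embeddings_le M (L : nat) : odd L -> 1 < L ->
  #|@cycle_embedding n L (planted M)| <= L * (4 * #|M|) * (5 * s + b) ^ (L - 2).
Proof.
move=> oddL L_gt1.
pose col x := if [pick v | emb v == x] is Some v then colour v else false.
have col_emb v : col (emb v) = colour v.
  by rewrite /col; case: pickP => [w /eqP /emb_inj ->|/(_ v)]; rewrite ?eqxx.
pose Pl := planted_edge @: setX [set: bool * bool] M.
have cardPl : #|Pl| <= 4 * #|M|.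
  by apply: leq_trans (leq_imset_card _ _) _; rewrite cardsX cardsT card_prod card_bool.
have cardW : #|emb @: [set: core s b]| <= 5 * s + b.
  apply: leq_trans (leq_imset_card _ _) _.
  rewrite cardsT !card_sum !card_prod card_bool !card_ord; lia.
apply: (@leq_trans (L * #|Pl| * #|emb @: [set: core s b]| ^ (L - 2))); last first.
  apply: leq_mul; first by rewrite leq_mul2l cardPl orbT.
  by case: (L - 2) => // e; rewrite leq_exp2r.
apply: (card_cycle_embedding_le (col := col)) => // x y.
  by case/gadjP=> [v [u [-> _ _]]]; rewrite imset_f.
case/gadjP=> [v [u [-> -> vu]]]; rewrite !col_emb.
case: v u vu => [[[p c] i]|[l|a]] [[[p' c'] j]|[l'|a']] //=.
- case/andP=> /eqP-> /eqP->; have [dM _|_] := boolP (cell p i j \in M); last by case: (c).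
  (* [cell p] is an involution, so this index yields the pair with indices [i] and [j]. *)
  apply/imsetP; exists ((p, c), cell p i j); first by rewrite !inE dM.
  by rewrite addbF; case: (p).
- by case: (c).
- by case: (c').
Qed.

(** * Many cycles through each planted edge *)

Lemma card_digit (N w l : nat) : 0 < w -> l.+1 * w <= N ->
  w <= #|[set y : 'I_N | y %/ w == l]|.
Proof.
move=> w_gt0 le_N.
have lt_N (c : 'I_w) : l * w + c < N by have := ltn_ord c; lia.
pose f c := Ordinal (lt_N c).
have f_inj : injective f by move=> c c' [] /addnI /val_inj.
rewrite -[leqLHS]card_ord -(card_imset _ f_inj).
apply/subset_leq_card/subsetP => _ /imsetP[c _ ->].
by rewrite inE /= divnMDl // divn_small ?addn0.
Qed.

(* A planted edge A_i A'_j is closed into a cycle by the paths A_i, Y, X, Y, ..., Y, A'_j;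
   drawing the [l]-th vertex from the [l]-th block of size [w] makes them simple. *)
Definition stop (k w : nat) (d : 'I_s * 'I_s) (l : 'I_(2 * k + 1)) : {set core s b} :=
  if l == 0 :> nat then [set inl (true, false, d.1)]
  else if l == 2 * k :> nat then [set inl (false, false, d.2)]
  else if odd l then [set inr (inl y) | y in [set y : 'I_s | y %/ w == l]]
  else [set inr (inr a) | a in [set a : 'I_b | a %/ w == l]].

(** Recovers the place on the cycle from the vertex, so the stops are disjoint and any choice from
    them is injective. *)
Definition stop_index (k w : nat) v : nat :=
  match v with
  | inl (p, _, _) => if p then 0 else 2 * k
  | inr (inl y) => y %/ w
  | inr (inr a) => a %/ w
  end.

Lemma stop_indexP (k w : nat) d (l : 'I_(2 * k + 1)) v :
  v \in stop w d l -> stop_index k w v = l.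
Proof.
rewrite /stop; case: eqP => [->|_]; first by rewrite inE => /eqP ->.
case: eqP => [->|_]; first by rewrite inE => /eqP ->.
by case: odd => /imsetP[y + ->]; rewrite inE => /eqP.
Qed.

(** For each cell of [M] the [2 * k - 1] inner stops offer [w] free choices each, and the two end
    vertices reveal the cell, so nothing is counted twice. *)
Lemma card_planted_embeddings_ge M (k w : nat) :
  0 < k -> 0 < w -> 2 * k * w <= s -> s <= b ->
  (forall (a : 'I_b) l, a < s -> (a, l) \in S) ->
  #|M| * w ^ (2 * k - 1) <= #|@cycle_embedding n (2 * k + 1) (planted M)|.
Proof.
move=> k_gt0 w_gt0 le_s le_b fullS.
pose F (d : 'I_s * 'I_s) (l : 'I_(2 * k + 1)) : pred 'I_n := mem (emb @: stop w d l).
have card_stop d (l : 'I_(2 * k + 1)) : (0 < l < 2 * k) -> w <= #|F d l|.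
  move=> /andP[l_gt0 l_lt]; rewrite card_imset // /stop gtn_eqF // ltn_eqF //.
  have le1 : l.+1 * w <= s by apply: leq_trans le_s; rewrite leq_mul2r l_lt orbT.
  case: odd; rewrite card_imset; try (by move=> y y' []); apply: card_digit => //.
  exact: leq_trans le_b.
have lt0 : 0 < 2 * k + 1 by rewrite addn1.
have lt2k : 2 * k < 2 * k + 1 by rewrite addn1.
have le_ord (x : 'I_(2 * k + 1)) : x <= 2 * k by rewrite -ltnS -[leqRHS]addn1; exact: ltn_ord.
pose o0 := Ordinal lt0; pose o2k := Ordinal lt2k.
apply: (leq_card_packing (F := fun d =>
  [pred f : {ffun 'I_(2 * k + 1) -> 'I_n} | f \in family (F d)])).
- move=> d f dM /familyP Ff.
  have {Ff} stop_f l : exists2 v, v \in stop w d l & f l = emb v.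
    by have /imsetP := Ff l.
  apply/andP; split.
    apply/injectiveP => l l' eq_f; apply: val_inj.
    have [v vl fl] := stop_f l; have [v' vl' fl'] := stop_f l'.
    move: eq_f; rewrite fl fl' => /emb_inj eq_v.
    by rewrite /= -(stop_indexP vl) eq_v (stop_indexP vl').
  apply/forallP => l.
  have [v + ->] := stop_f l; have [u + ->] := stop_f (ordS l).
  rewrite /= gadj_emb mem_map // mem_core_adj.
  (* The step from place [2 * k] back to 0 is the planted edge of [d]; all other steps are
     spokes. *)
  have := le_ord l; rewrite leq_eqVlt => /orP[/eqP l2k|lt_l].
    have ordS0 : ordS l = 0 :> nat by rewrite /= l2k -addn1 modnn.
    rewrite /stop ordS0 l2k /= eqxx eqn_leq leqNgt muln_gt0 k_gt0 /=.
    by rewrite !inE => /eqP-> /eqP->; rewrite /cell /= -surjective_pairing dM.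
  have ordS_l : ordS l = l.+1 :> nat by rewrite /= modn_small //; lia.
  rewrite /stop ordS_l /= [l == 2 * k :> nat]ltn_eqF //.
  case: (eqVneq (l : nat) 0) => [l0|l_n0].
    rewrite l0 /= (ltn_eqF (_ : 1 < 2 * k)); last by lia.
    by move=> /imsetP[y _ ->]; rewrite inE => /eqP ->.
  case: eqP => [l2k|l_n2k].
    have -> : odd l by have := congr1 odd l2k; rewrite /= oddM /= => /negbFE.
    by rewrite inE => /eqP-> /imsetP[y _ ->].
  (* All blocks in use lie among the first [s] indices, where [S] is full. *)
  have small (x : nat) : x %/ w < 2 * k -> x < s.
    by rewrite ltn_divLR // => /leq_trans; apply.
  case: (odd l) => /= /imsetP[y + ->] /imsetP[y' + ->]; rewrite !inE /= => /eqP hy /eqP hy'.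
    by apply: fullS; apply: small; rewrite hy; lia.
  by apply: fullS; apply: small; rewrite hy'.
- have ends d f : f \in family (F d) ->
      f o0 = emb (inl (true, false, d.1)) /\ f o2k = emb (inl (false, false, d.2)).
    move=> /familyP Ff; have /imsetP[v0 + ->] := Ff o0; have /imsetP[v1 + ->] := Ff o2k.
    by rewrite /stop /= eqxx eqn_leq leqNgt muln_gt0 k_gt0 /= !inE => /eqP-> /eqP->.
  move=> [i j] [i' j'] f _ _ /ends[f0 f2k] /ends[].
  by rewrite f0 f2k => /emb_inj[/= ->] /emb_inj[/= ->].
move=> d dM; rewrite (eq_card (B := family (F d))) // card_family_prod.
apply: (@leq_trans (\prod_(l < 2 * k + 1) if 0 < l < 2 * k then w else 1)).
  rewrite -(big_mkord xpredT (fun l => if 0 < l < 2 * k then w else 1)).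
  have [m ->] : exists m, 2 * k = m.+1 by exists (2 * k).-1; lia.
  rewrite addn1 subn1 big_nat_recl // big_nat_recr //= ltnn muln1 mul1n.
  rewrite (eq_big_nat _ _ (F2 := fun _ => w)) => [|l /andP[_ l_lt]]; last by rewrite ltnS l_lt.
  by rewrite prod_nat_const_nat subn0.
apply: leq_prod => l _; case: ifPn => [/card_stop -> //|].
rewrite negb_and -!leqNgt leqn0 /F /stop => l_end.
have l_le := le_ord l.
rewrite card_imset //; case: eqP l_end => [_ _|_ /=]; first by rewrite cards1.
by rewrite eqn_leq l_le => ->; rewrite cards1.
Qed.

End Planted.

(** * The lower bound *)

Lemma exists_superset_card (T : finType) (A : {set T}) (N : nat) :
  #|A| <= N <= #|T| -> exists2 S : {set T}, A \subset S & #|S| = N.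
Proof.
case/andP=> le_A le_T; pose e := enum A ++ enum (~: A).
have size_e : size e = #|T| by rewrite size_cat -!cardE cardsC.
have uniq_e : uniq e.
  rewrite cat_uniq !enum_uniq andbT; apply/hasPn => x.
  by rewrite !mem_enum inE.
exists [set x in take N e].
  apply/subsetP => x xA; rewrite inE take_cat -cardE ltnNge le_A.
  by rewrite mem_cat mem_enum xA.
rewrite cardsE (card_uniqP (take_uniq _ uniq_e)) size_takel //; lia.
Qed.

(** Cut an enumeration of [T] into consecutive runs of length [t]. *)
Lemma exists_disjoint_blocks (T : finType) (t : nat) :
  exists M : 'I_(#|T| %/ t) -> {set T},
    (forall r, #|M r| = t) /\ (forall r r' d, d \in M r -> d \in M r' -> r = r').
Proof.
have lt_T (r : 'I_(#|T| %/ t)) (c : 'I_t) : r * t + c < #|T|.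
  have le_T : r.+1 * t <= #|T|.
    by apply: leq_trans (leq_trunc_div _ t); rewrite leq_mul2r ltn_ord orbT.
  by have := ltn_ord c; lia.
pose f r c := enum_val (Ordinal (lt_T r c)) : T.
exists (fun r => [set f r c | c : 'I_t]); split => [r|r r' d].
  by rewrite card_imset ?card_ord // => c c' /enum_val_inj[/addnI /val_inj].
case/imsetP=> c _ -> /imsetP[c' _ /enum_val_inj[eq_c]].
have t_gt0 : 0 < t by apply: leq_ltn_trans (ltn_ord c).
apply: val_inj; have := congr1 (divn^~ t) eq_c.
by rewrite !divnMDl // (divn_small (ltn_ord c)) (divn_small (ltn_ord c')) !addn0.
Qed.

Lemma hard_family (k s t m n : nat) :
  0 < k -> 2 * k <= s -> 0 < t -> 5 * s ^ 2 <= m <= 20 * s ^ 2 -> 21 * s <= n ->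
  exists (G0 : graph n) (G : 'I_(s ^ 2 %/ t) -> graph n),
  [/\ one_hit G0 G,
      num_edges G0 = m /\ forall r, num_edges (G r) = m,
      num_cycles G0 (2 * k + 1) = 0,
      forall r, t * (s %/ (2 * k)) ^ (2 * k - 1) <=
                num_cycles (G r) (2 * k + 1) * (2 * k + 1) ^ (2 * k + 1) &
      forall r, num_cycles (G r) (2 * k + 1) <=
                (2 * k + 1) * (4 * t) * (21 * s) ^ (2 * k - 1)].
Proof.
move=> k_gt0 le_s t_gt0 /andP[ge_m le_m] le_n.
have s_gt0 : 0 < s by lia.
have card_cells : #|{: 'I_s * 'I_s}| = s ^ 2 by rewrite card_prod !card_ord mulnn.
have := exists_disjoint_blocks ('I_s * 'I_s)%type t.
rewrite card_cells => -[M [cardM disjM]].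
(* With [b = 16 * s], the size of [S] can be anything from [s ^ 2] (the full part [A]) to
   [16 * s ^ 2], which covers the range of [m]; the core then has [21 * s] vertices. *)
pose b := 16 * s; pose A := setX [set a : 'I_b | a < s] [set: 'I_s].
have [S sub_AS cardS] : exists2 S : {set 'I_b * 'I_s}, A \subset S & #|S| = m - 4 * s ^ 2.
  apply: exists_superset_card; apply/andP; split.
    have le_sb : s <= b by rewrite leq_pmull.
    rewrite cardsX cardsT card_ord.
    suff : #|[set a : 'I_b | a < s]| <= s by rewrite -mulnn in ge_m *; nia.
    rewrite -[leqRHS]card_ord.
    apply: leq_trans (leq_imset_card (widen_ord le_sb) predT).
    apply/subset_leq_card/subsetP => a; rewrite inE => lt_a.
    by apply/imsetP; exists (Ordinal lt_a) => //; apply: val_inj.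
  rewrite card_prod !card_ord /b -mulnA mulnn; lia.
have fullS (a : 'I_b) l : a < s -> (a, l) \in S.
  by move=> lt_a; apply: (subsetP sub_AS); rewrite !inE lt_a.
have card_core : #|{: core s b}| = 21 * s.
  rewrite !card_sum !card_prod card_bool !card_ord /b; lia.
have le_core : #|{: core s b}| <= n by rewrite card_core.
pose emb (v : core s b) := widen_ord le_core (enum_rank v).
have emb_inj : injective emb by move=> u v [/val_inj /enum_rank_inj].
have oddL : odd (2 * k + 1) by rewrite addn1 /= oddM.
have L_gt1 : 1 < 2 * k + 1 by lia.
have le_cycles N : num_cycles (planted S emb_inj N) (2 * k + 1) <=
    (2 * k + 1) * (4 * #|N|) * (21 * s) ^ (2 * k - 1).
  apply: leq_trans (num_cycles_le _ _) _.
  apply: leq_trans (card_planted_embeddings_le S emb_inj N oddL L_gt1) _.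
  have -> : 5 * s + b = 21 * s by rewrite /b; lia.
  by have -> : 2 * k + 1 - 2 = 2 * k - 1 by lia.
exists (planted S emb_inj set0), (fun r => planted S emb_inj (M r)); split.
- exact: planted_one_hit.
- by split => [|r]; rewrite num_edges_planted cardS; lia.
- by apply/eqP; rewrite -leqn0; apply: leq_trans (le_cycles _) _; rewrite cards0 !muln0.
- move=> r; rewrite -[t in leqLHS](cardM r).
  apply: leq_trans (le_num_cycles _ _).
  apply: card_planted_embeddings_ge => //; last exact: leq_pmull.
    by rewrite divn_gt0 // muln_gt0.
  by rewrite mulnC leq_trunc_div.
by move=> r; rewrite -(cardM r).
Qed.

Lemma leq_double_trunc_div (d s : nat) : 0 < d <= s -> s <= 2 * (s %/ d) * d.
Proof.
case/andP=> d_gt0 le_ds; apply: leq_trans (ltnW (ltn_ceil s d_gt0)) _.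
by rewrite leq_mul2r mul2n -addnn -[X in X <= _]addn1 leq_add2l divn_gt0 // le_ds orbT.
Qed.

(** The largest [s] with [5 * s ^ 2 <= m] works, since [s.+1 <= 2 * s]. *)
Lemma exists_sqrt_scale (m : nat) : 5 <= m -> exists s, 5 * s ^ 2 <= m <= 20 * s ^ 2.
Proof.
move=> m_ge5; have ex1 : exists s, 5 * s ^ 2 <= m by exists 1.
have bnd s : 5 * s ^ 2 <= m -> s <= m by rewrite -mulnn; nia.
have [s le_s max_s] := ex_maxnP ex1 bnd.
exists s; rewrite le_s /=; have s_gt0 := max_s 1 m_ge5.
rewrite leqNgt; apply/negP => lt_m.
have := max_s s.+1; rewrite ltnn => /implyP; rewrite implybF => /negP; apply.
by rewrite -!mulnn in lt_m *; nia.
Qed.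

Local Open Scope R_scope.

(** * Real powers and the final constants *)

Lemma INR_muln (a b : nat) : INR (a * b)%N = INR a * INR b.
Proof. exact: mult_INR. Qed.

Lemma INR_expn (a b : nat) : INR (a ^ b)%N = INR a ^ b.
Proof. by elim: b => //= b IH; rewrite expnS INR_muln IH. Qed.

Lemma leq_INR (a b : nat) : INR a <= INR b -> (a <= b)%N.
Proof. by move=> ab; apply/leP/INR_le. Qed.

Lemma INR_leq (a b : nat) : (a <= b)%N -> INR a <= INR b.
Proof. by move=> ab; apply/le_INR/leP. Qed.

Lemma INR_gt0 (a : nat) : (0 < a)%N -> 0 < INR a.
Proof. by move/ltP/lt_INR. Qed.

(** Translates the powers [k - 1/2] and [k + 1/2] of [m] into powers of [s], using
    [s <= sqrt m <= 5 * s]. *)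
Lemma sqrt_half_powers (k m s : nat) :
  (0 < k)%N -> (0 < s)%N -> (5 * s ^ 2 <= m <= 20 * s ^ 2)%N ->
  INR (s ^ (2 * k - 1))%N <= INR m ^ k / sqrt (INR m) /\
  INR m ^ k * sqrt (INR m) <= INR (5 * 20 ^ k * s ^ (2 * k + 1))%N.
Proof.
case: k => // k _ s_gt0 /andP[/INR_leq + /INR_leq].
rewrite !INR_muln !INR_expn; set x := INR s; set y := INR m.
have -> : INR 5 = 5 by simpl; lra.
have -> : INR 20 = 20 by simpl; lra.
move=> ge_y le_y.
have x_ge1 : 1 <= x by apply: (@INR_leq 1).
have y_gt0 : 0 < y by nra.
have sqrt_gt0 := sqrt_lt_R0 _ y_gt0.
have sqrt2 : sqrt y * sqrt y = y by apply: sqrt_sqrt; lra.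
have sqrt_ge : x <= sqrt y by nra.
have sqrt_le : sqrt y <= 5 * x by nra.
have -> : (2 * k.+1 - 1)%N = (2 * k).+1 by lia.
have -> : (2 * k.+1 + 1)%N = (2 * k.+1).+1 by lia.
have pow_odd j : x ^ (2 * j).+1 = x * (x ^ 2) ^ j by rewrite -pow_mult.
rewrite !pow_odd; split.
  have -> : y ^ k.+1 / sqrt y = sqrt y * y ^ k.
    by rewrite /= -{1}sqrt2; field; lra.
  apply: Rmult_le_compat => //; [lra | by apply: pow_le; nra | by apply: pow_incr; nra].
have -> : 5 * 20 ^ k.+1 * (x * (x ^ 2) ^ k.+1) = (20 * x ^ 2) ^ k.+1 * (5 * x).
  by rewrite Rpow_mult_distr; ring.
apply: Rmult_le_compat => //; [by apply: pow_le; lra | lra|].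
by apply: pow_incr; lra.
Qed.

Theorem theorem5p1 :
  forall k : nat, (1 <= k)%N ->
  exists c C : R, 0 < c /\ 1 <= C /\
  forall lam : R, 1 <= lam ->
  forall m T n : nat,
    C <= INR m ->
    C * (INR m ^ k / sqrt (INR m)) <= INR T ->
    C * INR T <= INR m ^ k * sqrt (INR m) ->
    C * INR m <= INR n ->
    forall A : alg n,
      (forall G : graph n, num_edges G = m ->
         2 / 3 <= prob G A (approxb lam (INR (num_cycles G (2 * k + 1))))) ->
      exists G : graph n,
        num_edges G = m /\
        INR T <= INR (num_cycles G (2 * k + 1)) <= C * INR T /\
        c * (INR m ^ k * sqrt (INR m)) / INR T <= INR (cost G A).
Proof.
move=> k k_gt0.
pose L := (2 * k + 1)%N; pose e := (2 * k - 1)%N.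
(* [D] is the loss from cells to cycles: [L ^ L] embeddings per cycle, and a factor [4 * k] between
   [s] and the block size [s %/ (2 * k)] at each of [e] free vertices. *)
pose D := (L ^ L * (4 * k) ^ e)%N.
(* Here 60 is 5 from [half_hi], 4 from rounding [t] and the family size, and 3 from the [#|I| / 3]
   of [one_hit_cost]. *)
pose B := (60 * 20 ^ k * D)%N.
(* The summands secure, in order, [2 * k + 5 <= s], [t <= s ^ 2] and the upper bound on the
   cycles. *)
pose C := (20 * (2 * k + 5) ^ 2 + 10 * 20 ^ k * D + 8 * L * 21 ^ e * D)%N.
have D_gt0 : (0 < D)%N by rewrite muln_gt0 !expn_gt0 muln_gt0 k_gt0 /L addn1.
have B_gt0 : 0 < INR B by apply: INR_gt0; rewrite muln_gt0 D_gt0 muln_gt0 expn_gt0.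
have C_ge1 : 1 <= INR C by apply: (@INR_leq 1); rewrite /C -mulnn; lia.
have C_ge8 : (8 * L * 21 ^ e * D <= C)%N by rewrite leq_addl.
have C_ge10 : (10 * 20 ^ k * D <= C)%N by rewrite /C addnAC leq_addl.
have C_ge20 : (20 * (2 * k + 5) ^ 2 <= C)%N by rewrite /C -addnA leq_addr.
exists (/ INR B), (INR C); split; first exact: Rinv_0_lt_compat.
split=> // lam lam_ge1 m T n le_Cm ge_T le_T le_n A good.
have {le_Cm} le_Cm := leq_INR le_Cm.
have [s bnd_s] : exists s, (5 * s ^ 2 <= m <= 20 * s ^ 2)%N.
  by apply: exists_sqrt_scale; rewrite (leq_trans _ le_Cm) // /C -mulnn; lia.
have le_s : (2 * k + 5 <= s)%N.
  have : (20 * (2 * k + 5) ^ 2 <= 20 * s ^ 2)%N.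
    by case/andP: bnd_s => _; apply: leq_trans; apply: leq_trans le_Cm.
  by rewrite leq_pmul2l // leq_exp2r.
have s_gt0 : (0 < s)%N by lia.
have [half_lo half_hi] := sqrt_half_powers k_gt0 s_gt0 bnd_s.
have se_gt0 : (0 < s ^ e)%N by rewrite expn_gt0 s_gt0.
have T_lo : (s ^ e <= T)%N.
  apply: leq_INR; have := Rle_trans _ _ _ (pos_INR _) half_lo.
  by move: half_lo ge_T; set z := _ / _; rewrite -/e; nra.
have T_hi : (C * T <= 5 * 20 ^ k * s ^ L)%N.
  by apply: leq_INR; apply: Rle_trans half_hi; rewrite INR_muln.
have sL : (s ^ L = s ^ 2 * s ^ e)%N by rewrite -expnD; congr (_ ^ _)%N; lia.
have {le_n} le_n : (21 * s <= n)%N.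
  have : (m <= n)%N by apply: leq_INR; have := pos_INR m; nra.
  by apply: leq_trans; case/andP: bnd_s => + _; apply: leq_trans; rewrite -mulnn; nia.
(* Enough cells for [T] cycles after the loss [D]. Since [s ^ e <= T], rounding up at most doubles
   the count. *)
pose t := ((D * T) %/ s ^ e).+1.
have t_lo : (D * T <= t * s ^ e)%N by apply: ltnW; apply: ltn_ceil.
have t_hi : (t * s ^ e <= 2 * D * T)%N.
  rewrite /t mulSn; have := leq_trunc_div (D * T) (s ^ e).
  by have := leq_mul D_gt0 T_lo; lia.
(* This makes the family nonempty. *)
have t_le : (t <= s ^ 2)%N.
  rewrite -(leq_pmul2r se_gt0) -sL (leq_trans t_hi) //.
  have : (5 * 20 ^ k * (2 * D * T) <= 5 * 20 ^ k * s ^ L)%N.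
    apply: leq_trans T_hi.
    have -> : (5 * 20 ^ k * (2 * D * T) = 10 * 20 ^ k * D * T)%N.
      by move: (20 ^ k)%N (D) (T) => a b c; clear; lia.
    by rewrite leq_mul2r C_ge10 orbT.
  by rewrite leq_pmul2l // muln_gt0 expn_gt0.
have [G0 [G [hitG [m0 mG] G0_free G_lo G_hi]]] :=
  hard_family k_gt0 (leq_trans (leq_addr _ _) le_s) (ltn0Sn _ : 0 < t)%N bnd_s le_n.
have cyc_lo r : (T <= num_cycles (G r) (2 * k + 1))%N.
  rewrite -(leq_pmul2l D_gt0); apply: leq_trans t_lo _.
  have le_w : (s <= 4 * k * (s %/ (2 * k)))%N.
    have -> : (4 * k * (s %/ (2 * k)) = 2 * (s %/ (2 * k)) * (2 * k))%N.
      by move: (s %/ (2 * k))%N => w; clear; lia.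
    by apply: leq_double_trunc_div; rewrite muln_gt0 k_gt0 (leq_trans _ le_s) // leq_addr.
  apply: leq_trans (_ : t * ((4 * k) ^ e * (s %/ (2 * k)) ^ e) <= _)%N.
    by rewrite leq_mul2l -expnMn leq_exp2r ?le_w ?orbT // subn_gt0; clear -k_gt0; lia.
  rewrite [leqLHS]mulnCA /D -mulnA [leqRHS]mulnCA [(L ^ L * _)%N]mulnC leq_mul2l.
  by rewrite (G_lo r) orbT.
have cyc_hi r : (num_cycles (G r) (2 * k + 1) <= C * T)%N.
  apply: leq_trans (G_hi r) _; rewrite -/L -/e expnMn.
  apply: leq_trans (_ : 8 * L * 21 ^ e * D * T <= _)%N; last by rewrite leq_mul2r C_ge8 orbT.
  have -> : (L * (4 * t) * (21 ^ e * s ^ e) = 4 * L * 21 ^ e * (t * s ^ e))%N.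
    by move: (21 ^ e)%N (s ^ e)%N (L) (t) => a b c d; clear; lia.
  have -> : (8 * L * 21 ^ e * D * T = 4 * L * 21 ^ e * (2 * D * T))%N.
    by move: (21 ^ e)%N (L) (D) (T) => a b c d; clear; lia.
  by rewrite leq_mul2l t_hi orbT.
have T_gt0 : 0 < INR T by apply: INR_gt0; apply: leq_trans T_lo.
have N_gt0 : (0 < #|'I_(s ^ 2 %/ t)|)%N by rewrite card_ord divn_gt0.
have [r||r|r cost_r] := @one_hit_cost n _ G0 G A lam
  (fun r => INR (num_cycles (G r) (2 * k + 1))) hitG N_gt0 lam_ge1.
- by apply: Rlt_le_trans T_gt0 _; apply: INR_leq.
- by have := good G0 m0; rewrite G0_free.
- exact: good.
exists (G r); split => //; split.
  by rewrite -INR_muln; split; apply: INR_leq.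
apply: Rle_trans cost_r; rewrite card_ord; set N := (s ^ 2 %/ t)%N.
(* One factor 2 comes from rounding down [s ^ 2 %/ t], the other from [t_hi]. *)
have le_N : (s ^ L <= 4 * N * D * T)%N.
  rewrite sL; apply: leq_trans (_ : 2 * N * t * s ^ e <= _)%N.
    by rewrite leq_mul2r leq_double_trunc_div ?orbT // t_le.
  have -> : (4 * N * D * T = 2 * N * (2 * D * T))%N.
    by move: (N) (D) (T) => a b c; clear; lia.
  by rewrite -mulnA leq_mul2l t_hi orbT.
have key : INR m ^ k * sqrt (INR m) <= INR B * (INR N / 3) * INR T.
  have -> : INR B * (INR N / 3) * INR T = INR (20 * 20 ^ k * D * N * T).
    have -> : (B = 3 * (20 * 20 ^ k * D))%N.
      by rewrite /B; move: (20 ^ k)%N (D) => a b; clear; lia.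
    rewrite !INR_muln; have -> : INR 3 = 3 by simpl; lra.
    by field.
  apply: Rle_trans half_hi _; apply: INR_leq.
  have -> : (20 * 20 ^ k * D * N * T = 5 * 20 ^ k * (4 * N * D * T))%N.
    by move: (20 ^ k)%N (N) (D) (T) => a b c d; clear; lia.
  by rewrite leq_mul2l le_N orbT.
apply: (Rmult_le_reg_l (INR B)) => //; apply: (Rmult_le_reg_r (INR T)) => //.
apply: Rle_trans key; right; field; lra.
Qed.
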